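(* Let $l \ge 9$ be an integer, $\tau = \lfloor l/3\rfloor$ and $a_l = \lfloor \sqrt{l}/2 \rfloor$. For $j = 1, \dots, \tau$ define $$g_l(j) = \frac{(l+j)^{(2j)}\,(l+j)^{(2j)}}{(l+3j)^{(2j)}\,(l-j)^{(2j)}}, \quad h_l(j) = \frac{l+j}{l-j}, \quad d(j) = g_l(j) - h_l(j),$$ and $$Q_l(j) = \frac{\frac{j(l-j)}{(l+j)^2}\binom{2(l+j)-1}{l+j-1}\binom{4l-1-2(l+j)}{l+j-1}}{\sum_{i=1}^{\tau} \frac{i(l-i)}{(l+i)^2}\binom{2(l+i)-1}{l+i-1}\binom{4l-1-2(l+i)}{l+i-1}}.$$ Then for each $j = 1, \dots, a_l$, $$d(a_l+1+j)\,Q_l(a_l+1+j) > -d(j)\,Q_l(j).$$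
   Context: For a real $x$ and integer $m \ge 0$, $x^{(m)} = x(x-1)\cdots(x-m+1)$ denotes the descending factorial power, with $x^{(0)}=1$. (For $l\ge 9$ one has $2a_l+1\le\tau$, so all indices appearing are in $\{1,\dots,\tau\}$.) *)

(* Defs.v *)
From mathcomp Require Import all_boot all_order all_algebra.
From mathcomp Require Import reals.

Set Implicit Arguments.
Unset Strict Implicit.
Unset Printing Implicit Defensive.

Import Order.TTheory GRing.Theory Num.Theory.
Local Open Scope ring_scope.

Definition descfact (R : realType) (x : R) (m : nat) : R :=
  \prod_(0 <= i < m) (x - i%:R).

Definition tau (l : nat) : nat := (l %/ 3)%N.

(* On nonnegative arguments [Num.truncn] is the floor, as a natural number. *)
Definition a_ (R : realType) (l : nat) : nat :=
  Num.truncn (Num.sqrt (l%:R : R) / 2).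

Definition g_ (R : realType) (l j : nat) : R :=
  (descfact (l%:R + j%:R) (2 * j) * descfact (l%:R + j%:R) (2 * j)) /
  (descfact (l%:R + 3 * j%:R) (2 * j) * descfact (l%:R - j%:R) (2 * j)).

Definition h_ (R : realType) (l j : nat) : R :=
  (l%:R + j%:R) / (l%:R - j%:R).

Definition d_ (R : realType) (l j : nat) : R := g_ R l j - h_ R l j.

(* The natural-number subtractions in the binomials are exact whenever
   1 <= j <= tau l, the only range in which this is used. *)
Definition Qweight (R : realType) (l j : nat) : R :=
  (j%:R * (l%:R - j%:R)) / (l%:R + j%:R) ^+ 2
  * 'C(2 * (l + j) - 1, l + j - 1)%:R
  * 'C(4 * l - 1 - 2 * (l + j), l + j - 1)%:R.

Definition Q_ (R : realType) (l j : nat) : R :=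
  Qweight R l j / \sum_(1 <= i < (tau l).+1) Qweight R l i.

(* Main.v *)
Require Import Defs.
From Stdlib Require Import ZArith.
From mathcomp Require Import all_boot all_order all_algebra.
From mathcomp Require Import reals sequences exp.
From mathcomp Require Import ring lra zify ssrZ.

Import Order.TTheory GRing.Theory Num.Theory.
Local Open Scope ring_scope.

(** Idea.  Up to the common normalisation, [h_l(j) Q_l(j)] and [g_l(j) Q_l(j)]
    are [j * hterm j] and [j * gterm j], where both sequences satisfy first-order
    recurrences with rational coefficients.  Put [x = 2j/sqrt l], [N = a_l+1+j],
    [y = 2N/sqrt l] and [e = 1/sqrt l], so that [1+x < y <= 1+x+2e].  Then [d]
    is at least about [(2N/l)(y^2-1)] at [N] and [-d] at most about
    [(2j/l)(1-x^2)] at [j], while [hterm N / hterm j] is at least about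
    [exp(-(y^2-x^2))].  Hence the claim is close to
      [x^2 (1-x^2) < y^2 (y^2-1) exp(-(y^2-x^2))],
    which holds with enough room to absorb the errors once [a_l >= 14], i.e.
    [e <= 1/28].  The finitely many remaining pairs [(l, j)] are checked by
    interval arithmetic on the recurrences. *)

(** * Factorial forms of the weighted sequences and their recurrences *)

Lemma descfact_fact (R : realType) (n m : nat) : (m <= n)%N ->
  descfact (n%:R : R) m * (n - m)`!%:R = n`!%:R.
Proof.
rewrite /descfact; elim: m => [|m IH] lemn; first by rewrite big_geq // mul1r subn0.
rewrite big_nat_recr //= -(IH (ltnW lemn)) -mulrA; congr (_ * _).
by rewrite -[in RHS](subnSK lemn) factS natrM subnSK // natrB // ltnW.
Qed.

(** The factor [j] is left out so that the sequence also starts at [j = 0], where it agrees with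
    [gterm]. *)
Definition hterm (R : realType) (l j : nat) : R :=
  (l + j)%:R * (2 * (l + j) - 1)`!%:R * (2 * (l - j) - 1)`!%:R
  / ((l + j)`!%:R ^+ 3 * (l - 3 * j)`!%:R).

(** Formally this is [hterm] at [-j]. *)
Definition gterm (R : realType) (l j : nat) : R :=
  (l - j)%:R * (2 * (l + j) - 1)`!%:R * (2 * (l - j) - 1)`!%:R
  / ((l - j)`!%:R ^+ 3 * (l + 3 * j)`!%:R).

Lemma fact_neq0 (R : realType) n : n`!%:R != 0 :> R.
Proof. by rewrite pnatr_eq0 -lt0n fact_gt0. Qed.

(** The upper index of the second binomial is [2(l-j)-1], which leaves [(l-3j)!] below. The square
    [(l+j)^2] turns both factors [(l+j-1)!] into [(l+j)!], whence the cube. *)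
Lemma Qweight_fact (R : realType) (l j : nat) : (0 < j)%N -> (3 * j <= l)%N ->
  Qweight R l j = j%:R * (l - j)%:R * (2 * (l + j) - 1)`!%:R *
     (2 * (l - j) - 1)`!%:R / ((l + j)`!%:R ^+ 3 * (l - 3 * j)`!%:R).
Proof.
move=> j0 jl; rewrite /Qweight.
have [k ek] : exists k, (l + j = k.+1)%N by exists (l + j).-1; lia.
have -> : (4 * l - 1 - 2 * (l + j) = 2 * (l - j) - 1)%N by lia.
have := @bin_fact (2 * (l + j) - 1) (l + j - 1) ltac:(lia).
have -> : (2 * (l + j) - 1 - (l + j - 1) = l + j)%N by lia.
move=> /(congr1 (fun n => n%:R : R)); rewrite !natrM => <-.
have := @bin_fact (2 * (l - j) - 1) (l + j - 1) ltac:(lia).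
have -> : (2 * (l - j) - 1 - (l + j - 1) = l - 3 * j)%N by lia.
move=> /(congr1 (fun n => n%:R : R)); rewrite !natrM => <-.
rewrite -natrD -natrB; last lia.
rewrite ek subSS subn0 factS natrM.
set A := (binomial _ _)%:R; set B := (binomial _ _)%:R.
field; rewrite !fact_neq0 /=.
by rewrite ?natr1 ?nat1r pnatr_eq0.
Qed.

Lemma h_Qweight (R : realType) (l j : nat) : (0 < j)%N -> (3 * j <= l)%N ->
  h_ R l j * Qweight R l j = j%:R * hterm R l j.
Proof.
move=> j0 jl; rewrite Qweight_fact // /h_ /hterm -natrB ?natrD; last lia.
field; rewrite !fact_neq0 /= pnatr_eq0; lia.
Qed.

(** In factorials [g_l(j)] is [(l+j)!^3 (l-3j)! / ((l-j)!^3 (l+3j)!)], so it exchanges the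
    denominator of the weight for the one with [-j]. *)
Lemma g_Qweight (R : realType) (l j : nat) : (0 < j)%N -> (3 * j <= l)%N ->
  g_ R l j * Qweight R l j = j%:R * gterm R l j.
Proof.
move=> j0 jl; rewrite Qweight_fact // /g_ /gterm -natrB; last lia.
rewrite -natrM -!natrD.
have /(canRL (mulfK (fact_neq0 _ _))) -> :=
  @descfact_fact R (l + j) (2 * j) ltac:(lia).
have /(canRL (mulfK (fact_neq0 _ _))) -> :=
  @descfact_fact R (l + 3 * j) (2 * j) ltac:(lia).
have /(canRL (mulfK (fact_neq0 _ _))) -> :=
  @descfact_fact R (l - j) (2 * j) ltac:(lia).
have -> : (l + j - 2 * j = l - j)%N by lia.
have -> : (l + 3 * j - 2 * j = l + j)%N by lia.
have -> : (l - j - 2 * j = l - 3 * j)%N by lia.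
by field; rewrite !fact_neq0.
Qed.

(** The ring is arbitrary because these ratios are used both over the reals and, for computation,
    over [Z]. *)
Definition hnum {R : nzRingType} (l k : R) : R :=
  (2 * l + 2 * k + 1) * ((l - 3 * k) * (l - 3 * k - 1)) * (l - 3 * k - 2).

Definition hden {R : nzRingType} (l k : R) : R :=
  (2 * l - 2 * k - 1) * (l - k - 1) * (l + k + 1) ^+ 2.

Definition gnum {R : nzRingType} (l k : R) : R :=
  (2 * l + 2 * k + 1) * (l + k) * (l - k) ^+ 2.

Definition gden {R : nzRingType} (l k : R) : R :=
  (2 * l - 2 * k - 1) * (l + 3 * k + 1) * (l + 3 * k + 2) * (l + 3 * k + 3).

Lemma htermS (R : realType) (l k : nat) : (3 * k.+1 <= l)%N ->
  hterm R l k.+1 * hden (l%:R : R) k%:R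
  = hterm R l k * hnum (l%:R : R) k%:R.
Proof.
move=> kl; rewrite /hterm /hnum /hden.
(* Writing [l] this way makes the truncated subtractions exact and every denominator visibly
   positive. *)
have [m ->] : exists m, l = (3 * k.+1 + m)%N by exists (l - 3 * k.+1)%N; lia.
have -> : (3 * k.+1 + m + k.+1 = (4 * k + m + 3).+1)%N by lia.
have -> : (3 * k.+1 + m + k = 4 * k + m + 3)%N by lia.
have -> : (2 * (4 * k + m + 3).+1 - 1 = (2 * (4 * k + m + 3) - 1).+2)%N by lia.
have -> : (2 * (3 * k.+1 + m - k) - 1 = (2 * (3 * k.+1 + m - k.+1) - 1).+2)%N by lia.
have -> : (3 * k.+1 + m - 3 * k.+1 = m)%N by lia.
have -> : (3 * k.+1 + m - 3 * k = m.+3)%N by lia.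
rewrite !factS !natrM.
have -> : ((2 * (4 * k + m + 3) - 1).+2 = 8 * k + 2 * m + 7)%N by lia.
have -> : ((2 * (4 * k + m + 3) - 1).+1 = 8 * k + 2 * m + 6)%N by lia.
have -> : ((2 * (3 * k.+1 + m - k.+1) - 1).+2 = 4 * k + 2 * m + 5)%N by lia.
have -> : ((2 * (3 * k.+1 + m - k.+1) - 1).+1 = 4 * k + 2 * m + 4)%N by lia.
set A := factorial _; set B := factorial _; set C := factorial _; set D := factorial _.
field; rewrite !fact_neq0 /=.
by have k0 := ler0n R k; have m0 := ler0n R m; rewrite !lt0r_neq0 //; lra.
Qed.

Lemma gtermS (R : realType) (l k : nat) : (3 * k.+1 <= l)%N ->
  gterm R l k.+1 * gden (l%:R : R) k%:R
  = gterm R l k * gnum (l%:R : R) k%:R.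
Proof.
move=> kl; rewrite /gterm /gnum /gden.
have [m ->] : exists m, l = (3 * k.+1 + m)%N by exists (l - 3 * k.+1)%N; lia.
have -> : (3 * k.+1 + m + k.+1 = (4 * k + m + 3).+1)%N by lia.
have -> : (3 * k.+1 + m + k = 4 * k + m + 3)%N by lia.
have -> : (2 * (4 * k + m + 3).+1 - 1 = (2 * (4 * k + m + 3) - 1).+2)%N by lia.
have -> : (2 * (3 * k.+1 + m - k) - 1 = (2 * (3 * k.+1 + m - k.+1) - 1).+2)%N by lia.
have -> : (3 * k.+1 + m + 3 * k.+1 = (6 * k + m + 3).+3)%N by lia.
have -> : (3 * k.+1 + m + 3 * k = 6 * k + m + 3)%N by lia.
have -> : (3 * k.+1 + m - k = (3 * k.+1 + m - k.+1).+1)%N by lia.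
rewrite !factS !natrM.
have -> : ((2 * (4 * k + m + 3) - 1).+2 = 8 * k + 2 * m + 7)%N by lia.
have -> : ((2 * (4 * k + m + 3) - 1).+1 = 8 * k + 2 * m + 6)%N by lia.
have -> : ((2 * (3 * k.+1 + m - k.+1) - 1).+2 = 4 * k + 2 * m + 5)%N by lia.
have -> : ((2 * (3 * k.+1 + m - k.+1) - 1).+1 = 4 * k + 2 * m + 4)%N by lia.
set A := factorial _; set B := factorial _; set C := factorial _; set D := factorial _.
have -> : (3 * k.+1 + m - k.+1 = 2 * k + m + 2)%N by lia.
field; rewrite !fact_neq0 /=.
by have k0 := ler0n R k; have m0 := ler0n R m; rewrite !lt0r_neq0 //; lra.
Qed.

(** * Exponential estimates and the inequality in scaled variables *)

(** After inversion the bound [exp w >= (1 + w/3)^3] suffices: it gives [v^2] the coefficient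
    [3/4 + 1/3 = 13/12 > 1], whereas [1 + w] would only give [3/4]. *)
Lemma expRN_le (R : realType) (v : R) : 0 <= v <= 1 / 8 ->
  expR (- (v + 3 / 4 * v ^+ 2)) <= 1 - v.
Proof.
move=> /andP[v0 v1]; rewrite expRN; set w := v + _.
have w0 : 0 <= w by rewrite /w; nra.
have w3 : (1 + w / 3) ^+ 3 <= expR w.
  have {2}-> : w = 3%:R * (w / 3) by field.
  rewrite expRM_natl; apply: lerXn2r; rewrite ?nnegrE ?expR_ge0 ?expR_ge1Dx //.
  by rewrite addr_ge0 // divr_ge0.
rewrite -[leRHS]invrK lef_pV2 ?posrE ?expR_gt0 ?invr_gt0 //; last by lra.
apply: le_trans w3; rewrite -[leLHS]mul1r ler_pdivrMr; last by lra.
rewrite /w.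
have v2 : v ^+ 2 <= v / 8 by nra.
apply: (@le_trans _ _ ((1 - v) * (1 + v + 13 / 12 * v ^+ 2 + v ^+ 3 / 2))); last first.
  rewrite mulrC ler_pM2r; last by lra.
  have v3 : 0 <= v ^+ 3 by rewrite exprn_ge0.
  have v4 : 0 <= v ^+ 4 by rewrite exprn_ge0.
  have v5 : 0 <= v ^+ 5 by rewrite exprn_ge0.
  have v6 : 0 <= v ^+ 6 by rewrite exprn_ge0.
  lra.
have -> : (1 - v) * (1 + v + 13 / 12 * v ^+ 2 + v ^+ 3 / 2) =
  1 + v ^+ 2 * (1 / 12 - 7 / 12 * v - v ^+ 2 / 2) by field.
have : 0 <= v ^+ 2 * (1 / 12 - 7 / 12 * v - v ^+ 2 / 2).
  by apply: mulr_ge0; [exact: sqr_ge0 | lra].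
lra.
Qed.

(* The tangent of [exp(-T)] at [T = 14/5 = 112/40], with [exp(-1/40)] replaced
   by its lower bound [1 - 1/40]. *)
Lemma expRN_tangent (R : realType) (T : R) :
  (1 - 1 / 40) ^+ 112 * (19 / 5 - T) <= expR (- T) :> R.
Proof.
have -> : expR (- T) = expR (- (1 / 40)) ^+ 112 * expR (14 / 5 - T).
  by rewrite -expRM_natl -expRD; congr expR; field.
have h1 : 1 - 1 / 40 <= expR (- (1 / 40)) :> R by apply: le_trans (expR_ge1Dx _); lra.
have h2 : 19 / 5 - T <= expR (14 / 5 - T) by apply: le_trans (expR_ge1Dx _); lra.
apply: le_trans (ler_wpM2l _ h2) _.
  by rewrite exprn_ge0 //; lra.
by rewrite ler_wpM2r ?expR_ge0 // lerXn2r ?nnegrE ?expR_ge0 //; lra.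
Qed.

(** The gap in the last claim of [bracket_large] after [e] is eliminated: [98/100] is below
    [1 - 1/56 - 1/784], and [2608/1000] is [19/5 - 1192/1000], from [expRN_lower] and
    [exponent_le]. *)
Definition margin_poly (R : realFieldType) (x : R) : R :=
  (1 + x) ^+ 2 * (x ^+ 2 + 187 / 100 * x - 2 / 100) * (117 / 2000) *
   (2608 / 1000 - 2266 / 1000 * x - 115 / 1000 * x ^+ 2)
   - x ^+ 2 * (1 - 98 / 100 * x ^+ 2).

(* The Bernstein coefficients of the polynomial on [1/10, 1] are positive, so
   the seven Bernstein products are all that [lra] needs. *)
Lemma margin_poly_gt0 (R : realFieldType) (x : R) :
  1 / 10 <= x <= 1 -> 0 < margin_poly _ x.
Proof.
move=> /andP[x0 x1]; rewrite /margin_poly.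
have bernstein m n : 0 <= (x - 1 / 10) ^+ m * (1 - x) ^+ n.
  by rewrite mulr_ge0 // exprn_ge0 // subr_ge0.
have := (bernstein 0%N 6%N, bernstein 1%N 5%N, bernstein 2%N 4%N, bernstein 3%N 3%N).
have := (bernstein 4%N 2%N, bernstein 5%N 1%N, bernstein 6%N 0%N).
move=> [[? ?] ?] [[[? ?] ?] ?]; lra.
Qed.

(** Since [112 = 7 * 2^4], four squarings suffice; rounding down before each keeps the rationals
    small. *)
Lemma exp_tangent_const (R : realFieldType) : 117 / 2000 <= (1 - 1 / 40) ^+ 112 :> R.
Proof.
have sq (p q t : R) n : 0 <= p -> q <= p ^+ 2 -> p <= t ^+ n -> q <= t ^+ (n * 2).
  move=> p0 qp pt; apply: (le_trans qp); rewrite exprM lerXn2r // nnegrE //.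
  exact: le_trans pt.
apply: (@sq (2419 / 10000) _ _ 56); [lra | lra |].
apply: (@sq (4919 / 10000) _ _ 28); [lra | lra |].
apply: (@sq (7014 / 10000) _ _ 14); [lra | lra |].
by apply: (@sq (8375 / 10000) _ _ 7); lra.
Qed.

Lemma expRN_lower (R : realType) (T : R) : T <= 19 / 5 ->
  117 / 2000 * (19 / 5 - T) <= expR (- T).
Proof.
move=> hT; apply: le_trans (expRN_tangent _ T).
by rewrite ler_wpM2r ?exp_tangent_const // subr_ge0.
Qed.

(** The worst case is [y = x + 15/14], [e = 1/28]; the constants are the coefficients of the
    resulting quadratic, rounded up. *)
Lemma exponent_le (R : realFieldType) (x y e : R) :
  0 < x <= 1 -> 1 + x <= y <= 1 + x + 2 * e -> 0 < e <= 1 / 28 ->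
  y ^+ 2 - x ^+ 2 + e * (y ^+ 3 - x ^+ 3)
    <= 1192 / 1000 + 2266 / 1000 * x + 115 / 1000 * x ^+ 2.
Proof.
move=> /andP[x0 x1] /andP[xy yx] /andP[e0 e1].
have y2 : y ^+ 2 <= (x + 15 / 14) ^+ 2 by rewrite lerXn2r ?nnegrE; lra.
have y3 : y ^+ 3 <= (x + 15 / 14) ^+ 3 by rewrite lerXn2r ?nnegrE; lra.
have xy3 : x ^+ 3 <= y ^+ 3 by rewrite lerXn2r ?nnegrE; lra.
have : e * (y ^+ 3 - x ^+ 3) <= 1 / 28 * ((x + 15 / 14) ^+ 3 - x ^+ 3).
  by apply: ler_pM; lra.
have x2 := sqr_ge0 x.
lra.
Qed.

Lemma bracket_mono (R : realFieldType) (z y e : R) :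
  0 < z <= y -> y <= 3 -> 0 < e <= 1 / 28 ->
  z ^+ 2 * (1 - z * e / 2 - e ^+ 2) <= y ^+ 2 * (1 - y * e / 2 - e ^+ 2).
Proof.
move=> /andP[z0 zy] y3 /andP[e0 e1].
rewrite -subr_ge0.
have -> : y ^+ 2 * (1 - y * e / 2 - e ^+ 2) - z ^+ 2 * (1 - z * e / 2 - e ^+ 2)
  = (y - z) * ((y + z) * (1 - e ^+ 2 - (y + z) * e / 2) + y * z * e / 2).
  by field.
have ye : (y + z) * e <= 6 * (1 / 28) by apply: ler_pM; lra.
have e2 : e ^+ 2 <= 1 / 28 * (1 / 28) by apply: ler_pM; lra.
apply: mulr_ge0; first lra.
apply: addr_ge0; first by apply: mulr_ge0; lra.
by rewrite divr_ge0 // !mulr_ge0 //; lra.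
Qed.

(** [B] is a lower bound free of [e], obtained from [e <= 1/28]; it is nonnegative only away from
    [x = 0]. *)
Lemma bracket_large (R : realFieldType) (x e : R) :
  1 / 10 <= x <= 1 -> 0 < e <= 1 / 28 ->
  let B := x ^+ 2 + 187 / 100 * x - 2 / 100 in
  [/\ 0 <= B, B <= (1 + x) ^+ 2 * (1 - (1 + x) * e / 2 - e ^+ 2) - 1 &
   x ^+ 2 * (1 - x ^+ 2 * (1 - x * e / 2 - e ^+ 2)) <
   (1 + x) ^+ 2 * B * (117 / 2000) *
     (2608 / 1000 - 2266 / 1000 * x - 115 / 1000 * x ^+ 2)].
Proof.
move=> /andP[x0 x1] /andP[e0 e1] B.
have x2 := sqr_ge0 x.
have e2 : e ^+ 2 <= 1 / 28 * (1 / 28) by apply: ler_pM; lra.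
split.
- by rewrite /B; lra.
- have : (1 + x) ^+ 2 * ((1 + x) * e / 2 + e ^+ 2)
      <= (1 + x) ^+ 2 * ((1 + x) / 56 + 1 / 784).
    rewrite ler_pM2l; last by rewrite exprn_gt0 //; lra.
    have : (1 + x) * e <= (1 + x) * (1 / 28) by apply: ler_pM; lra.
    lra.
  have : 0 <= x * (1 - x) by apply: mulr_ge0; lra.
  have : 0 <= x * (x * (1 - x)) by rewrite !mulr_ge0; lra.
  rewrite /B; clear -x0; lra.
- have xe : x * e <= 1 * (1 / 28) by apply: ler_pM; lra.
  have : x ^+ 2 * (1 - x ^+ 2 * (1 - x * e / 2 - e ^+ 2)) <=
      x ^+ 2 * (1 - 98 / 100 * x ^+ 2).
    apply: ler_wpM2l => //; rewrite lerD2l lerN2 [leRHS]mulrC.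
    by apply: ler_wpM2r => //; clear -e2 xe; lra.
  move=> /le_lt_trans; apply; rewrite -subr_gt0.
  by apply: margin_poly_gt0; rewrite x0.
Qed.

(** Near [0] a constant loss is not affordable. The hypothesis [2e <= x], which encodes [j >= 1],
    makes all losses proportional to [x], so [B] can be linear. *)
Lemma bracket_small (R : realFieldType) (x e : R) :
  0 < x <= 1 / 10 -> 0 < e <= 1 / 28 -> 2 * e <= x ->
  let B := 17 / 10 * x in
  [/\ 0 <= B, B <= (1 + x) ^+ 2 * (1 - (1 + x) * e / 2 - e ^+ 2) - 1 &
   x ^+ 2 * (1 - x ^+ 2 * (1 - x * e / 2 - e ^+ 2)) <
   (1 + x) ^+ 2 * B * (117 / 2000) *
     (2608 / 1000 - 2266 / 1000 * x - 115 / 1000 * x ^+ 2)].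
Proof.
move=> /andP[x0 xs] /andP[e0 e1] ex B.
have x2 : x ^+ 2 <= x / 10 by nra.
split.
- by rewrite /B; lra.
- have : (1 + x) ^+ 2 * ((1 + x) * e / 2 + e ^+ 2)
      <= (1 + x) ^+ 2 * ((1 + x) * (x / 4) + x ^+ 2 / 4).
    rewrite ler_pM2l; last by rewrite exprn_gt0 //; lra.
    have : (1 + x) * e <= (1 + x) * (x / 2) by apply: ler_pM; lra.
    have : e ^+ 2 <= x / 2 * (x / 2) by apply: ler_pM; lra.
    lra.
  have x3 : x ^+ 3 <= x / 100 by nra.
  have x4 : x ^+ 4 <= x / 1000 by nra.
  rewrite /B; clear -x0 x2 x3 x4; lra.
- have e2 : e ^+ 2 <= 1 / 28 * (1 / 28) by apply: ler_pM; lra.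
  have xe : x * e <= 1 * (1 / 28) by apply: ler_pM; lra.
  apply: (@le_lt_trans _ _ (x ^+ 2)).
    by rewrite ler_piMr ?sqr_ge0 // gerBl mulr_ge0 ?sqr_ge0 //; lra.
  (* This product is [0.1989 x], while [x^2 <= x/10]. *)
  apply: (@le_lt_trans _ _ (1 * (17 / 10 * x) * (117 / 2000) * 2)); first lra.
  apply: ltr_pM.
  + by clear -x0; lra.
  + by [].
  + rewrite !ltr_pM2r /B; [by clear -x0; nra | by clear -x0; lra | lra].
  + by clear -x0 xs x2; lra.
Qed.

(** The bracket increases with its argument, so [y] can be lowered to [1 + x] there, and the
    exponential is bounded below in [x] alone. The rest splits at [x = 1/10]. *)
Lemma core_ineq (R : realType) (x y e : R) :
  0 < x <= 1 -> 1 + x <= y <= 1 + x + 2 * e -> 0 < e <= 1 / 28 -> 2 * e <= x ->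
  x ^+ 2 * (1 - x ^+ 2 * (1 - x * e / 2 - e ^+ 2)) <
  y ^+ 2 * (y ^+ 2 * (1 - y * e / 2 - e ^+ 2) - 1)
    * expR (- (y ^+ 2 - x ^+ 2 + e * (y ^+ 3 - x ^+ 3))).
Proof.
move=> hx hy he ex.
have hT := exponent_le _ _ _ _ hx hy he.
move: (hx) (hy) (he) => /andP[x0 x1] /andP[xy yx] /andP[e0 e1].
set T := _ + e * _ in hT *.
have x2 : x ^+ 2 <= x by rewrite expr2 ler_piMr // ltW.
have hE0 : 0 <= 2608 / 1000 - 2266 / 1000 * x - 115 / 1000 * x ^+ 2.
  by clear -x1 x2; lra.
have hE : 117 / 2000 * (2608 / 1000 - 2266 / 1000 * x - 115 / 1000 * x ^+ 2)
    <= expR (- T).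
  by apply: le_trans (expRN_lower _ _ _); clear -hT hE0; lra.
have hB : (1 + x) ^+ 2 * (1 - (1 + x) * e / 2 - e ^+ 2)
    <= y ^+ 2 * (1 - y * e / 2 - e ^+ 2).
  by apply: bracket_mono => //; clear -x0 x1 xy yx e1; lra.
have [B [B0 hB1 hB2]] : exists B, [/\ 0 <= B,
   B <= (1 + x) ^+ 2 * (1 - (1 + x) * e / 2 - e ^+ 2) - 1 &
   x ^+ 2 * (1 - x ^+ 2 * (1 - x * e / 2 - e ^+ 2)) <
   (1 + x) ^+ 2 * B * (117 / 2000) *
     (2608 / 1000 - 2266 / 1000 * x - 115 / 1000 * x ^+ 2)].
  have [xl|/ltW xs] := lerP (1 / 10) x.
    by eexists; apply: bracket_large => //; rewrite xl.
  by eexists; apply: bracket_small => //; rewrite x0.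
have B1 : B <= y ^+ 2 * (1 - y * e / 2 - e ^+ 2) - 1.
  by apply: (le_trans hB1); rewrite lerD2r.
apply: (lt_le_trans hB2); rewrite -mulrA; apply: ler_pM => //.
- by apply: mulr_ge0 => //; exact: sqr_ge0.
- by apply: mulr_ge0 => //; clear; lra.
- apply: ler_pM => //; rewrite ?sqr_ge0 //.
  by rewrite lerXn2r ?nnegrE //; clear -x0 xy; lra.
Qed.

(* The sum over [j <= k < N] of [(8k+3)/l + 8(3k^2+3k+1)/l^2]; the first term is
   the [1/l]-part of [-ln (hterm (k+1) / hterm k)], and the second one exceeds
   the remaining part, which is about [12k^2/l^2]. *)
Definition decay (R : realType) (l j N : R) : R :=
  (4 * (N ^+ 2 - j ^+ 2) - (N - j)) / l + 8 * (N ^+ 3 - j ^+ 3) / l ^+ 2.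

(** Used at [N] as it stands and at [j] with the sign reversed. *)
Lemma bracket_scaled (R : realFieldType) (s z : R) : 0 < s -> 0 < z ->
  let l := s ^+ 2 in let n := z * s / 2 in let e := s^-1 in
  n * (8 * n ^+ 3 * (l - n) / (l * (l + 1)) - 2 * n) / (l + n) =
  z ^+ 2 * (z ^+ 2 * ((1 - z * e / 2) / (1 + e ^+ 2)) - 1) / (1 + z * e / 2) / 2.
Proof.
move=> s0 z0 l n e.
have s2 : 0 < s ^+ 2 by rewrite exprn_gt0.
have zs : 0 < z * s by rewrite mulr_gt0.
by rewrite /l /n /e; field; rewrite !gt_eqF //=; lra.
Qed.

(** Compared with [core_ineq], the denominators [l + n] cost a factor [(1 + ye/2) / (1 + xe/2)]. The
    term [-(N-j)/l] of [decay] pays for it with [exp((y-x)e/2)]. *)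
Lemma scaled_ineq (R : realType) (s x y : R) :
  28 <= s -> 2 * s^-1 <= x -> x <= 1 -> 1 + x <= y <= 1 + x + 2 * s^-1 ->
  let l := s ^+ 2 in let j := x * s / 2 in let N := y * s / 2 in
  0 <= j * (2 * j - 8 * j ^+ 3 * (l - j) / (l * (l + 1))) / (l + j) <
  N * (8 * N ^+ 3 * (l - N) / (l * (l + 1)) - 2 * N) / (l + N)
    * expR (- decay _ l j N).
Proof.
move=> s28 xs x1 hy; cbv zeta; set l := s ^+ 2; set j := x * s / 2; set N := y * s / 2.
have s0 : 0 < s by lra.
have x0 : 0 < x by apply: lt_le_trans xs; rewrite mulr_gt0 ?invr_gt0.
have y0 : 0 < y by lra.
set e := s^-1.
have e0 : 0 < e by rewrite invr_gt0.
have e1 : e <= 1 / 28 by rewrite div1r lef_pV2 ?posrE.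
have xe1 : x * e <= 1 * (1 / 28) by apply: ler_pM; lra.
have ye1 : y * e <= 3 * (1 / 28) by apply: ler_pM; lra.
have xye : 0 <= (y - x) * e * (x * e) by rewrite !mulr_ge0; lra.
have core := core_ineq _ x y e ltac:(lra) hy ltac:(lra) xs.
move: hy => /andP[xy yx].
have decayE : decay _ l j N =
    (y ^+ 2 - x ^+ 2 + e * (y ^+ 3 - x ^+ 3)) - (y - x) * e / 2.
  by rewrite /decay /l /j /N /e; field; rewrite gt_eqF.
rewrite decayE opprB [X in expR X]addrC expRD.
set E := expR (- _) in core *.
have E0 : 0 < E by exact: expR_gt0.
have hE : 1 + (y - x) * e / 2 <= expR ((y - x) * e / 2) by exact: expR_ge1Dx.
have e21 : 0 < 1 + e ^+ 2 by rewrite ltr_wpDr ?sqr_ge0.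
have xe0 : 0 < x * e by rewrite mulr_gt0.
have ye0 : 0 < y * e by rewrite mulr_gt0 //; lra.
(* The factor [1/(1+e^2)] is [l/(l+1)]. The bracket occurs negatively at [x] and positively at [y],
   so a lower bound serves both. *)
have lower z : 0 < z -> z * e <= 1 ->
    z ^+ 2 * (1 - z * e / 2 - e ^+ 2) <= z ^+ 2 * ((1 - z * e / 2) / (1 + e ^+ 2)).
  move=> z0 ze; rewrite ler_wpM2l ?sqr_ge0 // ler_pdivlMr //.
  have e2 := sqr_ge0 e.
  have e4 := sqr_ge0 (e ^+ 2).
  have : 0 <= z * e / 2 * e ^+ 2 by apply: mulr_ge0 => //; apply: divr_ge0 => //; apply: mulr_ge0; exact: ltW.
  lra.
have lx := lower x x0 ltac:(clear -xe1; lra).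
have ly : _ := lower y y0 ltac:(clear -ye1; lra).
have e2 := sqr_ge0 e.
have := (bracket_scaled _ s x s0 x0, bracket_scaled _ s y s0 y0).
cbv zeta; rewrite -/l -/j -/N -/e => -[jE NE].
have -> : j * (2 * j - 8 * j ^+ 3 * (l - j) / (l * (l + 1))) / (l + j) =
    x ^+ 2 * (1 - x ^+ 2 * ((1 - x * e / 2) / (1 + e ^+ 2))) / (1 + x * e / 2) / 2.
  apply: oppr_inj; rewrite -mulNr -mulrN opprB jE; ring.
rewrite NE.
set X := x ^+ 2 * (1 - _); set Y := y ^+ 2 * (_ - 1).
have XY : X < Y * E.
  apply: le_lt_trans (lt_le_trans core _).
    by rewrite ler_wpM2l ?sqr_ge0 // lerD2l lerN2.
  by rewrite ler_pM2r // ler_wpM2l ?sqr_ge0 // lerD2r.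
have X0 : 0 <= X.
  rewrite mulr_ge0 ?sqr_ge0 // subr_ge0 mulr_ile1 ?sqr_ge0 //.
  - by rewrite divr_ge0 //; [clear -xe1; lra | clear -e21; lra].
  - by rewrite exprn_ile1 // ltW.
  - by rewrite ler_pdivrMr //; clear -xe0 e2; lra.
apply/andP; split; first by rewrite !divr_ge0 //; clear -xe0; lra.
have YE0 : 0 < Y * E by apply: le_lt_trans X0 XY.
have -> : Y / (1 + y * e / 2) / 2 * (E * expR ((y - x) * e / 2)) =
  Y * E * expR ((y - x) * e / 2) / (1 + y * e / 2) / 2.
  by field; rewrite gt_eqF //; clear -ye0; lra.
rewrite ltr_pM2r; last by clear -ye0 xe0; lra.
rewrite ltr_pdivrMr; last by clear -ye0 xe0; lra.
apply: (lt_le_trans XY).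
rewrite -!(mulrA (Y * E)) ler_peMr ?(ltW YE0) //.
rewrite mulrAC ler_pdivlMr; last by clear -ye0 xe0; lra.
rewrite mul1r.
apply: le_trans (_ : (1 + (y - x) * e / 2) * (1 + x * e / 2) <= _); last first.
  by rewrite ler_pM2r //; clear -xe0; lra.
by clear -xye; lra.
Qed.

(** * Lower bound for [g_l(j)] *)

Lemma bernoulli (R : realDomainType) (c : R) n : 0 <= c -> 1 + n%:R * c <= (1 + c) ^+ n.
Proof.
move=> c0; elim: n => [|n IH]; first by rewrite mul0r addr0 expr0.
rewrite exprS -natr1; apply: le_trans (ler_wpM2l _ IH); last lra.
have : 0 <= n%:R * (c * c) by rewrite !mulr_ge0.
lra.
Qed.

(* Used with [t = l+1/2+z], [u = l+1/2-z] and [b = 2j]: pairing the factors of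
   [g_l(j)] symmetrically about [l+1/2] removes the first-order loss in [j/l]. *)
Lemma paired_factor (R : realFieldType) (b t u p : R) : 0 <= b ->
  b < t -> b < u -> t * u <= p ->
  (1 + b ^+ 2 / p) ^+ 2 <=
    (t ^+ 2 / ((t + b) * (t - b))) * (u ^+ 2 / ((u + b) * (u - b))).
Proof.
move=> b0 bt bu tup.
have tu : b ^+ 2 < t * u.
  by rewrite expr2; apply: ltr_pM.
set q := t * u in tu tup.
have b2 : 0 <= b ^+ 2 by apply: sqr_ge0.
have q0 : 0 < q by lra.
have h1 : 1 + b ^+ 2 / p <= q / (q - b ^+ 2).
  apply: (@le_trans _ _ (1 + b ^+ 2 / q)).
    by rewrite lerD2l ler_wpM2l // lef_pV2 ?posrE //; lra.
  rewrite ler_pdivlMr; last lra.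
  have -> : (1 + b ^+ 2 / q) * (q - b ^+ 2) = q - (b ^+ 2) ^+ 2 / q.
    by field; rewrite gt_eqF.
  by rewrite gerBl divr_ge0 ?sqr_ge0 // ltW.
apply: (@le_trans _ _ ((q / (q - b ^+ 2)) ^+ 2)).
  apply: lerXn2r => //; rewrite nnegrE.
    by rewrite addr_ge0 // divr_ge0 //; lra.
  by rewrite divr_ge0 //; lra.
rewrite mulf_div expr_div_n -exprMn -/q ler_wpM2l ?sqr_ge0 //.
have Dt : 0 < (t + b) * (t - b) by apply: mulr_gt0; lra.
have Du : 0 < (u + b) * (u - b) by apply: mulr_gt0; lra.
rewrite lef_pV2 ?posrE ?exprn_gt0 ?mulr_gt0 //; try lra.
rewrite -subr_ge0 (_ : _ - _ = (b * (t - u)) ^+ 2) ?sqr_ge0 //.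
by rewrite /q; ring.
Qed.

(** Multiplying the product for [g_l(j)] by its reversal pairs factors whose [t] sum to [2l+1]. Each
    of the [2j] pairs is at least [(1+c)^2] with [c = 4j^2/(l(l+1))]; a square root and Bernoulli's
    inequality give [1 + 2jc]. *)
Lemma g_lower (R : realType) (l j : nat) : (0 < j)%N -> (3 * j <= l)%N ->
  1 + 8 * j%:R ^+ 3 / (l%:R * (l%:R + 1)) <= g_ R l j.
Proof.
move=> j0 jl.
pose t (i : nat) : R := l%:R + j%:R - i%:R.
pose b : R := 2 * j%:R.
pose F (x : R) := x ^+ 2 / ((x + b) * (x - b)).
have gE : g_ R l j = \prod_(0 <= i < 2 * j) F (t i).
  rewrite /g_ /descfact -!big_split -prodf_div /=.
  apply: eq_bigr => i _; rewrite /F /t /b.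
  by congr (_ / (_ * _)); ring.
pose p : R := l%:R * (l%:R + 1).
have jR : 1 <= (j%:R : R) by rewrite ler1n.
have jlR : 3 * j%:R <= (l%:R : R) by rewrite -natrM ler_nat.
have p0 : 0 < p by rewrite mulr_gt0; lra.
pose c := b ^+ 2 / p.
have c0 : 0 <= c by rewrite divr_ge0 ?sqr_ge0 ?ltW.
have tb i : (i < 2 * j)%N -> b < t i.
  move=> ij; rewrite /b /t.
  have : i%:R + 1 <= 2 * j%:R :> R by rewrite natr1 -natrM ler_nat.
  lra.
have Fpos i : (i < 2 * j)%N -> 0 < F (t i).
  move=> /tb bt; have b0 : 0 < b by rewrite /b; lra.
  by rewrite divr_gt0 ?exprn_gt0 ?mulr_gt0 //; lra.
have g0 : 0 <= g_ R l j.
  rewrite gE big_nat; apply: prodr_ge0 => i /andP[_ ij]; exact/ltW/Fpos.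
suff : (1 + c) ^+ (2 * j) <= g_ R l j.
  apply: le_trans; apply: le_trans (bernoulli _ _ _ c0).
  by rewrite /c /b /p natrM le_eqVlt; apply/orP; left; apply/eqP; ring.
rewrite -(@ler_pXn2r _ 2) ?nnegrE ?exprn_ge0 //; last lra.
rewrite [leRHS]expr2 {1}gE big_nat_rev gE -big_split -exprM mulnC exprM /=.
rewrite -[X in (_ ^+ X) <= _]subn0 -prodr_const_nat.
rewrite big_nat [leRHS]big_nat.
apply: ler_prod => i /andP[_ ij]; rewrite exprn_ge0 /=; last lra.
apply: paired_factor; [rewrite /b; lra | apply: tb; lia | exact: tb |].
rewrite /t /p add0n natrB; last lia.
have ij' : i%:R + 1 <= 2 * j%:R :> R by rewrite natr1 -natrM ler_nat.
rewrite -natr1 natrM.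
(* This is [l(l+1)] minus the paired product; it is nonnegative because [i - j] is an integer. *)
have : 0 <= (i%:R - j%:R) * (i%:R - j%:R + 1) :> R.
  have [ile|jle] := ltnP i j.
    have : i%:R + 1 <= j%:R :> R by rewrite natr1 ler_nat.
    by move=> h; rewrite mulr_le0 //; lra.
  have : j%:R <= i%:R :> R by rewrite ler_nat.
  by move=> h; rewrite mulr_ge0 //; lra.
lra.
Qed.

(** * Decay of [hterm] *)

Lemma hterm_gt0 (R : realType) (l j : nat) : (0 < l)%N -> (0 < hterm R l j).
Proof.
move=> l0; have fact0 n : 0 < n`!%:R :> R by rewrite ltr0n fact_gt0.
by rewrite /hterm divr_gt0 // !mulr_gt0 ?exprn_gt0 // ltr0n addn_gt0 l0.
Qed.

(** Invert [exp(u^2-u) >= 1-u+u^2] and use [(1+u)(1-u+u^2) = 1+u^3]. *)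
Lemma expR_le1Dsqr (R : realType) (u : R) : 0 <= u -> expR (u - u ^+ 2) <= 1 + u.
Proof.
move=> u0; have h := expR_ge1Dx (u ^+ 2 - u).
have u3 : 0 <= u ^+ 3 by rewrite exprn_ge0.
have h0 : 0 < 1 + (u ^+ 2 - u) by nra.
rewrite -opprB expRN; apply: (@le_trans _ _ (1 + (u ^+ 2 - u))^-1).
  by rewrite lef_pV2 ?posrE ?expR_gt0.
by rewrite -[leLHS]mul1r ler_pdivrMr //; lra.
Qed.

(** Each linear factor, divided by its leading term in [l], is compared with an exponential. The
    first-order terms sum exactly to [-(8k+3)/l]; the second-order ones leave the positive slack
    computed for [hE]. The hypothesis says [(3k+2)/l <= 1/8], as [expRN_le] needs. *)
Lemma hnum_lower (R : realType) (l k : R) : 0 <= k -> 24 * k + 16 <= l ->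
  hden l k *
    expR (- ((8 * k + 3) / l + 8 * (3 * k ^+ 2 + 3 * k + 1) / l ^+ 2))
  <= hnum l k.
Proof.
move=> k0 kl; have l0 : 0 < l by lra.
pose v := 3 * k / l; pose v1 := (3 * k + 1) / l; pose v2 := (3 * k + 2) / l.
pose u := (k + 2^-1) / l; pose u1 := (k + 1) / l.
have bd x : 0 <= x -> 8 * x <= l -> 0 <= x / l <= 1 / 8.
  by move=> x0 xl; apply/andP; split; [apply: divr_ge0 => //; exact: ltW | rewrite ler_pdivrMr //; lra].
have hv : 0 <= v <= 1 / 8 by apply: bd; lra.
have hv1 : 0 <= v1 <= 1 / 8 by apply: bd; lra.
have hv2 : 0 <= v2 <= 1 / 8 by apply: bd; lra.
have hu : 0 <= u <= 1 / 8 by apply: bd; lra.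
have hu1 : 0 <= u1 <= 1 / 8 by apply: bd; lra.
have lE x : x / l * l = x by rewrite divfK ?gt_eqF.
have -> : hnum l k = 2 * l ^+ 4 * ((1 + u) * ((1 - v) * (1 - v1) * (1 - v2))).
  by rewrite /hnum /hden /u /v /v1 /v2; field; rewrite gt_eqF.
have -> : hden l k = 2 * l ^+ 4 * ((1 - u) * (1 - u1) * (1 + u1) ^+ 2).
  by rewrite /hnum /hden /u /u1; field; rewrite gt_eqF.
rewrite -[leLHS]mulrA ler_pM2l; last by rewrite mulr_gt0 // exprn_gt0.
pose w (x : R) := x + 3 / 4 * x ^+ 2.
have hE : - ((8 * k + 3) / l + 8 * (3 * k ^+ 2 + 3 * k + 1) / l ^+ 2) <=
    (u + u1 - u1 *+ 2) + ((u - u ^+ 2) + (- w v - w v1 - w v2)).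
  rewrite -subr_ge0.
  have -> : (u + u1 - u1 *+ 2) + ((u - u ^+ 2) + (- w v - w v1 - w v2)) -
    - ((8 * k + 3) / l + 8 * (3 * k ^+ 2 + 3 * k + 1) / l ^+ 2) =
    (11 / 4 * k ^+ 2 + 19 / 2 * k + 4) / l ^+ 2.
    by rewrite /w /v /v1 /v2 /u /u1; field; rewrite gt_eqF.
  by apply: divr_ge0; [have := sqr_ge0 k; lra | exact: sqr_ge0].
move: hE; rewrite -ler_expR => hE.
have expD (x : R) : 1 + x <= expR x := expR_ge1Dx x.
have h1 : (1 - u) * (1 - u1) * (1 + u1) ^+ 2 <= expR (- (u + u1 - u1 *+ 2)).
  have -> : - (u + u1 - u1 *+ 2) = - u + - u1 + 2%:R * u1 by rewrite mulr_natl; ring.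
  rewrite !expRD expRM_natl.
  apply: ler_pM; [apply: mulr_ge0; lra | by rewrite sqr_ge0 | |].
    by apply: ler_pM; [lra | lra | exact: expD | exact: expD].
  by apply: lerXn2r; rewrite ?nnegrE ?expR_ge0 ?expD //; lra.
have h2 : expR ((u - u ^+ 2) + (- w v - w v1 - w v2)) <=
    (1 + u) * ((1 - v) * (1 - v1) * (1 - v2)).
  rewrite (expRD (u - u ^+ 2)) (expRD (- w v - w v1)) (expRD (- w v)).
  apply: ler_pM.
  - by rewrite expR_ge0.
  - by rewrite !mulr_ge0 ?expR_ge0.
  - by apply: expR_le1Dsqr; lra.
  - apply: ler_pM; rewrite ?mulr_ge0 ?expR_ge0 //; last exact: expRN_le.
    by apply: ler_pM; rewrite ?expR_ge0 //; exact: expRN_le.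
apply: le_trans h2; apply: le_trans (ler_wpM2l _ hE) _.
  by rewrite !mulr_ge0 ?sqr_ge0 //; lra.
rewrite expRD mulrA ler_piMl ?expR_ge0 //.
apply: le_trans (ler_wpM2r (expR_ge0 _) h1) _.
by rewrite mulrC expRxMexpNx_1.
Qed.

(** [decay] telescopes the exponents of [hnum_lower]; [l + 8] encodes [24k + 16 <= l] at the last
    step [k = j+n-1]. *)
Lemma hterm_decay (R : realType) (l j n : nat) : (24 * (j + n) <= l + 8)%N -> (0 < l)%N ->
  hterm R l j * expR (- decay _ l%:R j%:R (j + n)%:R) <= hterm R l (j + n).
Proof.
move=> nl l0.
have lR : (l%:R : R) != 0 by rewrite pnatr_eq0 -lt0n.
elim: n nl => [|n IH] nl.
  by rewrite addn0 /decay !subrr subr0 !mulr0 !mul0r addr0 oppr0 expR0 mulr1.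
have {IH}/(_ ltac:(lia)) IH := IH.
rewrite addnS in nl *; set N := (j + n)%N in nl IH *.
have step := @hnum_lower R l%:R N%:R (ler0n _ _).
have {}step := step ltac:(by rewrite -natrM -natrD ler_nat; lia).
have NR : 0 <= (N%:R : R) by [].
have NlR : 24 * N%:R + 16 <= (l%:R : R) by rewrite -natrM -natrD ler_nat; lia.
have den0 : 0 < hden (l%:R : R) N%:R.
  by rewrite /hnum /hden !mulr_gt0 ?exprn_gt0 //; lra.
rewrite -(ler_pM2r den0) htermS; last lia.
have -> : decay _ l%:R j%:R N.+1%:R = decay R l%:R j%:R N%:R +
   ((8 * N%:R + 3) / l%:R + 8 * (3 * N%:R ^+ 2 + 3 * N%:R + 1) / l%:R ^+ 2).
  by rewrite /decay -natr1; field.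
rewrite opprD expRD mulrA -[leLHS]mulrA [X in _ * X <= _]mulrC.
apply: ler_pM => //.
- by rewrite mulr_ge0 ?expR_ge0 ?ltW ?hterm_gt0.
- by rewrite mulr_ge0 ?expR_ge0 ?ltW.
Qed.

(** * The case [a_l >= 14] *)

Lemma Qweight_gt0 (R : realType) (l j : nat) : (0 < j)%N -> (3 * j <= l)%N ->
  0 < Qweight R l j.
Proof.
move=> j0 jl; rewrite /Qweight -natrB; last lia.
by rewrite !mulr_gt0 ?invr_gt0 ?exprn_gt0 -?natrD ?ltr0n ?bin_gt0 //; lia.
Qed.

(** Here [gterm / hterm = g/h], and [g_lower] bounds [g]. At [N] this bounds the gain from below;
    negated, at [j], it bounds the loss from above. *)
Lemma excess_lower (R : realType) (l n : nat) : (0 < n)%N -> (3 * n <= l)%N ->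
  hterm R l n * (n%:R * (8 * n%:R ^+ 3 * (l%:R - n%:R) / (l%:R * (l%:R + 1)) - 2 * n%:R)
    / (l%:R + n%:R)) <= n%:R * (gterm R l n - hterm R l n).
Proof.
move=> n0 nl.
have nR : 0 < n%:R :> R by rewrite ltr0n.
have nlR : 3 * n%:R <= l%:R :> R by rewrite -natrM ler_nat.
have w0 := @Qweight_gt0 R l n n0 nl.
have gE := @g_Qweight R l n n0 nl; have hE := @h_Qweight R l n n0 nl.
have h0 : 0 < h_ R l n by rewrite /h_ divr_gt0 //; lra.
have H0 : 0 < hterm R l n by apply: hterm_gt0; lia.
rewrite [leRHS]mulrBr -gE.
have -> : g_ R l n * Qweight R l n = n%:R * hterm R l n * (g_ R l n / h_ R l n).
  by rewrite -hE; field; rewrite gt_eqF.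
apply: le_trans (_ : n%:R * hterm R l n *
    ((1 + 8 * n%:R ^+ 3 / (l%:R * (l%:R + 1))) / h_ R l n) - n%:R * hterm R l n <= _).
  rewrite le_eqVlt; apply/orP; left; apply/eqP; rewrite /h_.
  by field; rewrite !gt_eqF //=; lra.
rewrite lerD2r; apply: ler_wpM2l; first by rewrite mulr_ge0 // ltW.
by rewrite ler_pM2r ?invr_gt0 // g_lower.
Qed.

Lemma a_bounds (R : realType) (l : nat) :
  (4 * a_ R l ^ 2 <= l < 4 * (a_ R l).+1 ^ 2)%N.
Proof.
have := truncn_itv (x := Num.sqrt (l%:R : R) / 2) ltac:(by rewrite divr_ge0 ?sqrtr_ge0).
rewrite -/(a_ R l) => /andP[al la].
have sl : Num.sqrt (l%:R : R) ^+ 2 = l%:R by rewrite sqr_sqrtr.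
have s0 := sqrtr_ge0 (l%:R : R).
have a0 : 0 <= (a_ R l)%:R :> R by [].
apply/andP; split.
  rewrite -(ler_nat R) natrM natrX -sl.
  have : (a_ R l)%:R ^+ 2 <= (Num.sqrt (l%:R : R) / 2) ^+ 2 by rewrite lerXn2r ?nnegrE //; lra.
  lra.
rewrite -(ltr_nat R) natrM natrX -sl.
have : (Num.sqrt (l%:R : R) / 2) ^+ 2 < (a_ R l).+1%:R ^+ 2 by rewrite ltrXn2r ?nnegrE //; lra.
lra.
Qed.

Lemma large_case (R : realType) (a l j : nat) :
  (14 <= a)%N -> (4 * a ^ 2 <= l < 4 * a.+1 ^ 2)%N -> (1 <= j <= a)%N ->
  j%:R * (hterm R l j - gterm R l j) <
  (a + 1 + j)%:R * (gterm R l (a + 1 + j) - hterm R l (a + 1 + j)).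
Proof.
move=> a14 /andP[al la] /andP[j1 ja]; set N := (a + 1 + j)%N.
(* Hence [l >= 56 a], which makes the index bounds below linear. *)
have aa : (14 * a <= a ^ 2)%N by rewrite -mulnn leq_mul2r a14 orbT.
have l3 : (3 * N <= l)%N by rewrite /N; lia.
have jl3 : (3 * j <= l)%N by lia.
have l24 : (24 * (j + (a + 1)) <= l + 8)%N by lia.
have l28 : (28 ^ 2 <= l)%N by apply: leq_trans al; rewrite -[28%N]/(2 * 14)%N expnMn leq_pmul2l // leq_sqr.
have l0 : (0 < l)%N by exact: leq_trans l28.
pose s : R := Num.sqrt l%:R.
have s2 : s ^+ 2 = l%:R by rewrite sqr_sqrtr.
have s0 : 0 < s by rewrite sqrtr_gt0 ltr0n.
have sge0 := ltW s0.
have s28 : 28 <= s.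
  by rewrite -(@ler_pXn2r _ 2) ?nnegrE // s2 -natrX ler_nat.
have as2 : a%:R * 2 <= s.
  rewrite -(@ler_pXn2r _ 2) ?nnegrE ?mulr_ge0 // s2 exprMn -natrX -natrX -natrM ler_nat.
  by rewrite mulnC.
have sa : s < (a%:R + 1) * 2.
  rewrite natr1 -(@ltr_pXn2r _ 2) ?nnegrE ?mulr_ge0 // s2 exprMn -natrX -natrX -natrM ltr_nat.
  by rewrite mulnC.
have jR : 1 <= j%:R :> R by rewrite ler1n.
have jaR : j%:R <= a%:R :> R by rewrite ler_nat.
have NE : N%:R = a%:R + 1 + j%:R :> R by rewrite !natrD.
pose x : R := j%:R * 2 / s; pose y : R := N%:R * 2 / s.
have jE : x * s / 2 = j%:R by rewrite /x; field; rewrite gt_eqF.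
have Ny : y * s / 2 = N%:R by rewrite /y; field; rewrite gt_eqF.
have yE : y = x + (a%:R + 1) * 2 / s by rewrite /x /y NE; field; rewrite gt_eqF.
have x1 : x <= 1 by rewrite ler_pdivrMr // mul1r; lra.
have x2 : 2 * s^-1 <= x by rewrite /x ler_pM2r ?invr_gt0 //; lra.
(* Both bounds come from [2a <= s < 2(a+1)], as [y - x = 2(a+1)/s]. *)
have hy : 1 + x <= y <= 1 + x + 2 * s^-1.
  rewrite yE [1 + x]addrC -addrA !lerD2l ler_pdivlMr // mul1r (ltW sa) /=.
  rewrite ler_pdivrMr // [leRHS]mulrDl mul1r divfK ?gt_eqF //; lra.
have := scaled_ineq R s x y s28 x2 x1 hy.
cbv zeta; rewrite jE Ny s2 => /andP[X0 XY].
have low_j := @excess_lower R l j j1 jl3.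
have low_N := @excess_lower R l N (ltn_addl _ j1) l3.
have dec := @hterm_decay R l j (a + 1) l24 l0.
rewrite [(j + _)%N]addnC -/N in dec.
apply: lt_le_trans low_N.
set X := (X in 0 <= X) in X0 XY.
set Y := (Y in _ < Y * _) in XY *.
set E := expR _ in XY dec.
have E0 : 0 < E by exact: expR_gt0.
have Y0 : 0 < Y by rewrite -(pmulr_lgt0 _ E0); apply: le_lt_trans XY.
have hj0 : 0 < hterm R l j by apply: hterm_gt0.
apply: (@le_lt_trans _ _ (hterm R l j * X)).
  rewrite -lerN2 -[leRHS]mulrN opprB; apply: le_trans low_j.
  rewrite -[leLHS]mulrN le_eqVlt; apply/orP; left; apply/eqP; congr (_ * _).
  by rewrite /X; ring.
apply: (@lt_le_trans _ _ (hterm R l j * (Y * E))); first by rewrite ltr_pM2l.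
by rewrite [Y * E]mulrC mulrA ler_pM2r.
Qed.

(** * Verified computation for [a_l <= 13] *)

(* Fixed-point bounds for [hterm k / hterm 0], rounded up, and for
   [gterm k / gterm 0], rounded down; note that [hterm 0 = gterm 0]. *)
Fixpoint bounds (l : Z) (m : nat) (k h g : Z) : seq (Z * Z) :=
  (h, g) :: if m isn't m'.+1 then [::] else
    bounds l m' (k + 1)
      (Z.succ (Z.div (h * hnum l k) (hden l k)))
      (Z.div (g * gnum l k) (gden l k)).

Definition scaleZ : Z := Z.pow 2 28.

(** Upper bounds on [h] and lower bounds on [g] suffice at both indices, because [h - g] stands on
    the smaller side and [g - h] on the larger. *)
Definition check_pair (s : seq (Z * Z)) (j N : nat) : bool :=
  let: (hj, gj) := nth (Z0, Z0) s j in
  let: (hN, gN) := nth (Z0, Z0) s N in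
  j%:R * (hj - gj) < N%:R * (gN - hN).

Definition check_l (a l : nat) : bool :=
  let s := bounds l%:R (2 * a + 1) 0 scaleZ scaleZ in
  all (fun j => check_pair s j (a + 1 + j)) (iota 1 a).

(** The length [8a + 4] is [4(a+1)^2 - 4a^2], so the range covers all [l] with [a_l = a]. *)
Definition check_a (a : nat) : bool :=
  all (check_l a) [seq l <- iota (4 * a ^ 2) (8 * a + 4) | (9 <= l)%N].

Lemma check_all : all check_a (iota 1 13).
Proof. by vm_compute. Qed.

Definition ZR (R : realType) : {rmorphism Z -> R} :=
  GRing.RMorphism.clone Z R (intr \o int_of_Z) _.

Lemma rmorph_ratios (S R : nzRingType) (f : {rmorphism S -> R}) (l k : S) :
  [/\ f (hnum l k) = hnum (f l) (f k), f (hden l k) = hden (f l) (f k),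
      f (gnum l k) = gnum (f l) (f k) & f (gden l k) = gden (f l) (f k)].
Proof.
by rewrite /hnum /hden /gnum /gden;
  split; rewrite !(rmorph_nat, rmorph1, rmorphB, rmorphM, rmorphXn, rmorphD).
Qed.

Lemma ZR_lt (R : realType) x y : (ZR R x < ZR R y) = (x < y).
Proof. by rewrite ltr_int; lia. Qed.

Lemma ZR_le (R : realType) x y : (ZR R x <= ZR R y) = (x <= y).
Proof. by rewrite ler_int; lia. Qed.

Lemma ZR_div_le (R : realType) (x d : Z) : 0 < ZR R d ->
  ZR R d * ZR R (Z.div x d) <= ZR R x.
Proof.
rewrite -(rmorph0 (ZR R)) ZR_lt => d0; rewrite -rmorphM ZR_le.
by have := Z.mul_div_le x d; lia.
Qed.

Lemma ZR_div_gt (R : realType) (x d : Z) : 0 < ZR R d ->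
  ZR R x <= ZR R d * ZR R (Z.succ (Z.div x d)).
Proof.
rewrite -(rmorph0 (ZR R)) ZR_lt => d0; rewrite -rmorphM ZR_le.
by have := Z.mul_succ_div_gt x d; lia.
Qed.

Definition bounded (R : realType) (l k : nat) (h g : Z) : Prop :=
  hterm R l k * ZR R scaleZ <= ZR R h * hterm R l 0 /\
  ZR R g * hterm R l 0 <= gterm R l k * ZR R scaleZ.

(** Outward rounding keeps the bounds valid, since for these [k] the numerators are nonnegative and
    the denominators positive. *)
Lemma bounded_step (R : realType) (l k : nat) (h g : Z) : (3 * k.+1 <= l)%N ->
  bounded R l k h g ->
  let L : Z := l%:R in let K : Z := k%:R in
  bounded R l k.+1 (Z.succ (Z.div (h * hnum L K) (hden L K)))
                 (Z.div (g * gnum L K) (gden L K)).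
Proof.
move=> kl [hb gb] L K.
have kR : 0 <= k%:R :> R by [].
have klR : 3 * k%:R + 3 <= l%:R :> R by rewrite -natrM -natrD ler_nat; lia.
have hd0 : 0 < hden (l%:R : R) k%:R.
  by rewrite /hnum /hden !mulr_gt0 ?exprn_gt0 //; lra.
have gd0 : 0 < gden (l%:R : R) k%:R.
  by rewrite /gnum /gden !mulr_gt0 //; lra.
have hn0 : 0 <= hnum (l%:R : R) k%:R.
  by rewrite /hnum /hden !mulr_ge0 //; lra.
have gn0 : 0 <= gnum (l%:R : R) k%:R.
  by rewrite /gnum /gden !mulr_ge0 ?exprn_ge0 //; lra.
have C0 : 0 < hterm R l 0 by apply: hterm_gt0; lia.
have [] := rmorph_ratios _ _ (ZR R) L K.
rewrite !rmorph_nat => hnE hdE gnE gdE.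
split.
  rewrite -(ler_pM2r hd0) mulrAC htermS // mulrAC.
  apply: (@le_trans _ _ (ZR R h * hterm R l 0 * hnum (l%:R : R) k%:R)).
    by rewrite ler_wpM2r.
  rewrite mulrAC [leRHS]mulrAC ler_pM2r // -hnE -rmorphM [leRHS]mulrC -hdE.
  by apply: ZR_div_gt; rewrite hdE.
rewrite -(ler_pM2r gd0) [leRHS]mulrAC gtermS // [leRHS]mulrAC.
apply: (@le_trans _ _ (ZR R g * hterm R l 0 * gnum (l%:R : R) k%:R)); last first.
  by rewrite ler_wpM2r.
rewrite mulrAC [leRHS]mulrAC ler_pM2r // -gnE -rmorphM mulrC -gdE.
by apply: ZR_div_le; rewrite gdE.
Qed.

(** The list has [m + 1] entries, so for [i <= m] the default of [nth] is never read. *)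
Lemma bounds_sound (R : realType) (l m k i : nat) (h g : Z) :
  (3 * (k + m) <= l)%N -> (i <= m)%N -> bounded R l k h g ->
  let p := nth (Z0, Z0) (bounds l%:R m k%:R h g) i in
  bounded R l (k + i) p.1 p.2.
Proof.
elim: m k i h g => [|m IH] k [|i] h g kl im bd //; rewrite ?addn0 //.
rewrite addnS -addSn.
have kl1 : (3 * k.+1 <= l)%N by lia.
have := IH k.+1 i _ _ ltac:(lia) im (bounded_step _ _ _ _ _ kl1 bd).
by rewrite -natr1.
Qed.

Lemma gterm0 (R : realType) (l : nat) : gterm R l 0 = hterm R l 0.
Proof. by rewrite /gterm /hterm muln0 !subn0 !addn0. Qed.

Lemma small_case (R : realType) (a l j : nat) :
  (a <= 13)%N -> (9 <= l)%N -> (4 * a ^ 2 <= l < 4 * a.+1 ^ 2)%N -> (1 <= j <= a)%N ->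
  j%:R * (hterm R l j - gterm R l j) <
  (a + 1 + j)%:R * (gterm R l (a + 1 + j) - hterm R l (a + 1 + j)).
Proof.
move=> a13 l9 /andP[al la] /andP[j1 ja]; set N := (a + 1 + j)%N.
have := check_all => /allP /(_ a); rewrite mem_iota => /(_ ltac:(lia)).
move=> /allP /(_ l); rewrite mem_filter l9 mem_iota.
move=> /(_ ltac:(rewrite /=; nia)) /allP /(_ j); rewrite mem_iota => /(_ ltac:(lia)).
have l3 : (3 * (2 * a + 1) <= l)%N by nia.
have b0 : bounded R l 0 scaleZ scaleZ by rewrite /bounded gterm0 mulrC.
have sound i : (i <= 2 * a + 1)%N -> _ := fun hi =>
  @bounds_sound R l (2 * a + 1) 0 i scaleZ scaleZ ltac:(lia) hi b0.
rewrite /check_pair.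
have := sound j ltac:(lia); have := sound N ltac:(lia); rewrite -/N !add0n.
set s := bounds _ _ _ _ _; cbv zeta.
case: (nth _ s N) => hN gN bN; case: (nth _ s j) => hj gj bj.
rewrite -(ZR_lt R) !(rmorphM, rmorphB, rmorph_nat) => lt.
have [hhN hgN] : bounded R l N hN gN := bN.
have [hhj hgj] : bounded R l j hj gj := bj.
have C0 : 0 < hterm R l 0 by apply: hterm_gt0; lia.
have M0 : 0 < ZR R scaleZ by rewrite -(rmorph0 (ZR R)) ZR_lt.
move: (ZR R scaleZ) M0 hhN hgN hhj hgj => M M0 hhN hgN hhj hgj.
rewrite -(ltr_pM2r M0).
apply: (@le_lt_trans _ _ (j%:R * (ZR R hj - ZR R gj) * hterm R l 0)).
  by rewrite -!mulrA ler_wpM2l // !mulrBl lerB.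
apply: (@lt_le_trans _ _ (N%:R * (ZR R gN - ZR R hN) * hterm R l 0)).
  by rewrite ltr_pM2r.
by rewrite -!mulrA ler_wpM2l // !mulrBl lerB.
Qed.

(** * Normalisation and conclusion *)

Lemma Qweight_sum_gt0 (R : realType) (l : nat) : (9 <= l)%N ->
  0 < \sum_(1 <= i < (tau l).+1) Qweight R l i.
Proof.
move=> l9; rewrite /tau big_ltn; last lia.
apply: ltr_wpDr; last by apply: Qweight_gt0; lia.
rewrite big_nat; apply: sumr_ge0 => i /andP[i2 it].
by apply/ltW/Qweight_gt0; lia.
Qed.

Theorem theorem1p3 (R : realType) (l : nat) (hl : (9 <= l)%N) (j : nat)
    (hj : (1 <= j <= a_ R l)%N) :
  d_ R l (a_ R l + 1 + j) * Q_ R l (a_ R l + 1 + j) > - d_ R l j * Q_ R l j.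
Proof.
have := a_bounds R l; move: (a_ R l) hj => a ja al.
(* For [a >= 2] this follows from [4a^2 <= l]; for [a = 1] it is [9 <= l]. *)
have l3 : (3 * (a + 1 + j) <= l)%N.
  by move: ja al => /andP[j1 ja] /andP[al _]; nia.
have main : j%:R * (hterm R l j - gterm R l j) <
    (a + 1 + j)%:R * (gterm R l (a + 1 + j) - hterm R l (a + 1 + j)).
  by have [a13|a14] := leqP a 13; [exact: small_case | exact: large_case].
have dQ n : (0 < n)%N -> (3 * n <= l)%N ->
    d_ R l n * Qweight R l n = n%:R * (gterm R l n - hterm R l n).
  by move=> n0 nl; rewrite /d_ mulrBl g_Qweight // h_Qweight // mulrBr.
rewrite /Q_ [ltLHS]mulrA [ltRHS]mulrA ltr_pM2r ?invr_gt0 ?Qweight_sum_gt0 //.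
rewrite mulNr !dQ; try lia.
by rewrite -[ltLHS]mulrN opprB.
Qed.
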